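(* The algebra $bH_n(q)$ is a free $\mathbb{S}$--module with basis $\mathcal{G}_n=\{\operatorname{E}_\mathbf{I} z_w\mid \mathbf{I}\in\mathcal{LP}_n,\ w\in\mathfrak{S}_{\|\mathbf{I}\|}\}$. In particular \[\dim bH_n(q)=\sum_{(\mu_1,\ldots,\mu_k)\in\mathcal{C}_n}\mu_1!\cdots\mu_k!,\] where $\mathcal{C}_n$ is the set of compositions of $n$ with no zero parts.
   Context: $\mathbb{S}=\mathbb{C}[q,q^{-1}]$. The tied--boxed Hecke algebra $bH_n(q)$ is the $\mathbb{S}$--algebra presented by generators $e_1,\dots,e_{n-1}$, $z_1,\dots,z_{n-1}$ and relations: $e_i^2=e_i$, $e_ie_j=e_je_i$ (all $i,j$); $z_iz_jz_i=z_jz_iz_j$ if $|i-j|=1$, $z_iz_j=z_jz_i$ if $|i-j|>1$; $e_iz_i=z_i$; $e_iz_j=z_je_i$ (all $i,j$); $z_i^2=e_i+(q-q^{-1})z_i$. $\mathcal{LP}_n$ is the set of linear set partitions of $[n]$ (all blocks are intervals). For $\mathbf{I}\in\mathcal{LP}_n$, $\operatorname{E}_\mathbf{I}=\prod e_i$, the product over those $i\in[n-1]$ such that $i$ and $i+1$ lie in the same block of $\mathbf{I}$; $\|\mathbf{I}\|$ is the composition of block sizes (in increasing order of blocks), and $\mathfrak{S}_{\|\mathbf{I}\|}$ is the Young subgroup of $\mathfrak{S}_n$ of permutations preserving each block of $\mathbf{I}$. For $w\in\mathfrak{S}_n$ with reduced expression $s_{i_1}\cdots s_{i_k}$, $z_w=z_{i_1}\cdots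 z_{i_k}$ (independent of the reduced expression by the braid relations). *)

(* Defs.v *)
From HB Require Import structures.
From mathcomp Require Import all_boot all_order all_algebra all_fingroup.
From mathcomp Require Import complex fraction.
From mathcomp Require Import boolp Rstruct.
From mathcomp Require Import zify ring.

Set Implicit Arguments.
Unset Strict Implicit.
Unset Printing Implicit Defensive.

Import Order.TTheory GRing.Theory Num.Theory FracField.
Notation "x %:F" := (@FracField.tofrac _ x).
Local Open Scope ring_scope.

(* The complex numbers C := R[i] (R = the Stdlib reals) and the ring   *)
(* S = C[q, q^-1] of Laurent polynomials, realised as the subring of   *)
(* the field of rational functions C(q) consisting of the p / q^k.     *)

Definition CC : fieldType := (Rdefinitions.R)[i]%C.
Definition Kq := {fraction {poly CC}}.

Definition laurent_pred : {pred Kq} :=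
  fun x => `[< exists (p : {poly CC}) (k : nat), x = p%:F / ('X ^+ k)%:F >].

Lemma Xk_neq0 k : ('X ^+ k : {poly CC})%:F != 0.
Proof. by rewrite tofrac_eq0 expf_neq0 // polyX_eq0. Qed.

Lemma frac_sub_gen (F : fieldType) (a b c d : F) : b != 0 -> d != 0 ->
  a / b - c / d = (a * d - c * b) / (b * d).
Proof. by move=> hb hd; field; rewrite hb hd. Qed.

Lemma frac_mul_gen (F : fieldType) (a b c d : F) :
  (a / b) * (c / d) = (a * c) / (b * d).
Proof. by rewrite invfM mulrACA. Qed.

Lemma laurent_subring : subring_closed laurent_pred.
Proof.
split.
- apply/asboolP; exists 1, 0%N; by rewrite expr0 divr1.
- move=> x y /asboolP [p [k ->]] /asboolP [r [m ->]]; apply/asboolP.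
  exists (p * 'X ^+ m - r * 'X ^+ k), (k + m)%N.
  rewrite exprD tofracM tofracB !tofracM.
  exact: frac_sub_gen (Xk_neq0 k) (Xk_neq0 m).
- move=> x y /asboolP [p [k ->]] /asboolP [r [m ->]]; apply/asboolP.
  exists (p * r), (k + m)%N.
  rewrite exprD !tofracM.
  exact: frac_mul_gen.
Qed.

HB.instance Definition _ := GRing.isSubringClosed.Build Kq laurent_pred
  laurent_subring.

Record Laurent := MkLaurent { lval : Kq; lvalP : lval \in laurent_pred }.
HB.instance Definition _ := [isSub for lval].
HB.instance Definition _ := [Choice of Laurent by <:].
HB.instance Definition _ := [SubChoice_isSubComNzRing of Laurent by <:].

Notation S := Laurent.

Lemma q_in : ('X : {poly CC})%:F \in laurent_pred.
Proof. by apply/asboolP; exists 'X, 0%N; rewrite expr0 divr1. Qed.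

Lemma qinv_in : (('X : {poly CC})%:F)^-1 \in laurent_pred.
Proof. by apply/asboolP; exists 1, 1%N; rewrite expr1 tofrac1 div1r. Qed.

Definition qS : S := MkLaurent q_in.
Definition qinvS : S := MkLaurent qinv_in.

(* Positions 1..n are 'I_n (0-based); generator indices i = 1..n-1 are *)
(* 'I_n.-1 (0-based): k : 'I_n.-1 stands for i = k+1, joining the      *)
(* positions lo k (= i) and hi k (= i+1).                              *)

Lemma lo_proof n (k : 'I_n.-1) : (k < n)%N.
Proof. have := ltn_ord k; lia. Qed.
Lemma hi_proof n (k : 'I_n.-1) : (k.+1 < n)%N.
Proof. have := ltn_ord k; lia. Qed.

Definition lo n (k : 'I_n.-1) : 'I_n := Ordinal (lo_proof k).
Definition hi n (k : 'I_n.-1) : 'I_n := Ordinal (hi_proof k).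

Definition sgen n (k : 'I_n.-1) : 'S_n := tperm (lo k) (hi k).

Definition reduced_word n (w : 'S_n) (s : seq 'I_n.-1) : Prop :=
  (\prod_(k <- s) sgen k)%g = w /\
  forall t : seq 'I_n.-1, (\prod_(k <- t) sgen k)%g = w -> (size s <= size t)%N.

Definition interval_set n (B : {set 'I_n}) : bool :=
  [forall x in B, forall y in B, forall p : 'I_n,
     ((x <= p)%N && (p <= y)%N) ==> (p \in B)].

Definition linear_partition n (P : {set {set 'I_n}}) : bool :=
  partition P [set: 'I_n] && [forall B in P, interval_set B].

Definition joined n (P : {set {set 'I_n}}) (k : 'I_n.-1) : bool :=
  [exists B in P, (lo k \in B) && (hi k \in B)].

Definition young n (P : {set {set 'I_n}}) (w : 'S_n) : bool :=
  [forall B in P, [set w x | x in B] == B].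

Definition Gindex n : {set {set {set 'I_n}} * 'S_n} :=
  [set Iw | linear_partition Iw.1 & young Iw.1 Iw.2].

(* The defining relations of bH_n(q) in an S-algebra A, for elements    *)
(* e_i, z_i of A and the scalar c = q - q^-1.                           *)

Definition bH_relations n (R : comNzRingType) (c : R) (A : algType R)
  (e z : 'I_n.-1 -> A) : Prop :=
  (forall i, e i * e i = e i) /\
      (forall i j, e i * e j = e j * e i) /\
      (forall i j : 'I_n.-1, (i.+1 == j :> nat) || (j.+1 == i :> nat) ->
        z i * z j * z i = z j * z i * z j) /\
      (forall i j : 'I_n.-1, (i.+1 < j)%N || (j.+1 < i)%N ->
        z i * z j = z j * z i) /\
      (forall i, e i * z i = z i) /\
      (forall i j, e i * z j = z j * e i) /\
      (forall i, z i * z i = e i + c *: z i).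

Inductive bgen n := GenE of 'I_n.-1 | GenZ of 'I_n.-1.

Definition eval_word n (R : comNzRingType) (A : algType R)
  (e z : 'I_n.-1 -> A) (u : seq (bgen n)) : A :=
  \prod_(g <- u) (match g with GenE i => e i | GenZ i => z i end).

Definition E_of n (R : comNzRingType) (A : algType R) (e : 'I_n.-1 -> A)
  (P : {set {set 'I_n}}) : A :=
  \prod_(k : 'I_n.-1 | joined P k) e k.

(* z_w, computed along the word s (a reduced expression of w) *)
Definition z_of n (R : comNzRingType) (A : algType R) (z : 'I_n.-1 -> A)
  (s : seq 'I_n.-1) : A :=
  \prod_(k <- s) z k.

(* Main.v *)
Require Import Defs.
From HB Require Import structures.
From mathcomp Require Import all_boot all_order all_algebra all_fingroup.
From mathcomp Require Import zify ring.

Set Implicit Arguments.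
Unset Strict Implicit.
Unset Printing Implicit Defensive.

Import GRing.Theory.
Local Open Scope ring_scope.

(* Everything is indexed by the set J of generators joined by a linear
   partition instead of by the partition itself. Since the e_i are central
   idempotents with e_i z_i = z_i, left multiplication by a generator k sends
   E_J z_w to a combination of E_(J u k) z_w and E_(J u k) z_(s_k w), which gives
   spanning (Matsumoto's theorem makes z_w independent of the chosen word).
   For freeness, each J gives a representation on the regular module of the
   Hecke algebra of S_n, with e_k = 1, z_k = T_k for k in J and e_k = z_k = 0
   otherwise; it kills E_K unless K is contained in J and maps E_J z_w to T_w, so
   coefficients vanish by induction on #|J|. The cardinality of a Young subgroup
   is computed by orbit-stabilizer along the chain of its subgroups fixing
   all positions >= m. *)

(** * Inversions, reduced words and Matsumoto's theorem *)

Section Inversions.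
Variable n : nat.
Implicit Types (i j k : 'I_n.-1) (x y : 'I_n) (w v : 'S_n) (s t : seq 'I_n.-1).

Lemma sgenE k x : (sgen k x : nat) =
  if (x == k :> nat) then k.+1 else if (x == k.+1 :> nat) then (k : nat) else x.
Proof.
rewrite /sgen; case: tpermP => [->|->|/eqP h1 /eqP h2] /=.
- by rewrite eqxx.
- by rewrite eqxx; case: eqP => //; lia.
- by move: h1 h2; rewrite -!val_eqE /= => /negPf -> /negPf ->.
Qed.

Lemma sgenK k : (sgen k * sgen k = 1)%g.
Proof. exact: tperm2. Qed.

Lemma sgenMK k w : (sgen k * (sgen k * w) = w)%g.
Proof. by rewrite mulgA sgenK mul1g. Qed.

Lemma sgen_comm i j : (i.+1 < j)%N || (j.+1 < i)%N ->
  (sgen i * sgen j = sgen j * sgen i)%g.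
Proof.
move=> ij; apply/permP => x; rewrite !permM; apply: val_inj => /=.
by rewrite !sgenE; do !case: ifP; lia.
Qed.

Lemma sgen_braid i j : (i.+1 == j :> nat) || (j.+1 == i :> nat) ->
  (sgen i * (sgen j * sgen i) = sgen j * (sgen i * sgen j))%g.
Proof.
move=> ij; apply/permP => x; rewrite !permM; apply: val_inj => /=.
by rewrite !sgenE; do !case: ifP; lia.
Qed.

(** Permutations compose from left to right, so [sgen k * w] exchanges the values of [w] at [lo k]
    and [hi k]: this is the descent condition for left multiplication. *)
Definition descent k w := (w (hi k) < w (lo k))%N.

Definition inversions w : {set 'I_n * 'I_n} :=
  [set p : 'I_n * 'I_n | (p.1 < p.2)%N && (w p.2 < w p.1)%N].

Definition inv w := #|inversions w|.

Lemma descent_sgen k w : descent k (sgen k * w) = ~~ descent k w.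
Proof.
rewrite /descent !permM tpermL tpermR -leqNgt [RHS]leq_eqVlt.
case: eqP => // /ord_inj /perm_inj /(congr1 val) /=; lia.
Qed.

Lemma sgen_ltn k x y : (x < y)%N -> (x, y) != (lo k, hi k) ->
  (sgen k x < sgen k y)%N.
Proof.
move=> xy; rewrite xpair_eqE -!val_eqE /= => h; rewrite !sgenE.
by do !case: ifP; lia.
Qed.

(** The pair [(lo k, hi k)] becomes an inversion, and applying [sgen k] to both coordinates matches
    the remaining inversions with those of [w]. *)
Lemma inv_ascent k w : ~~ descent k w -> inv (sgen k * w) = (inv w).+1.
Proof.
move=> asc.
have lohi : (lo k, hi k) \in inversions (sgen k * w).
  rewrite inE /= ltnSn /=.
  by have := descent_sgen k w; rewrite asc /descent => ->.
rewrite /inv (cardsD1 (lo k, hi k)) lohi add1n; congr _.+1.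
pose f (p : 'I_n * 'I_n) := (sgen k p.1, sgen k p.2).
have fK : involutive f by move=> [x y]; rewrite /f /= !tpermK.
rewrite -[RHS](card_imset _ (inv_inj fK)); congr #|pred_of_set _|.
apply/setP => p; rewrite (can2_imset_pre _ fK fK) !inE; case: p => x y /=.
rewrite !permM; apply/idP/idP.
  by case/and3P => ne xy ->; rewrite sgen_ltn.
case/andP => xy wxy; rewrite wxy andbT.
have ne : (sgen k x, sgen k y) != (lo k, hi k).
  apply: contraNneq asc => -[ex ey]; rewrite /descent -ex -ey //.
have := sgen_ltn xy ne; rewrite !tpermK => ->; rewrite andbT.
by apply/eqP => -[ex ey]; move: xy; rewrite ex ey tpermL tpermR /=; lia.
Qed.

Lemma inv_descent k w : descent k w -> inv w = (inv (sgen k * w)).+1.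
Proof.
by move=> dk; rewrite -[in LHS](sgenMK k w) inv_ascent // descent_sgen dk.
Qed.

Lemma inv1 : inv 1 = 0%N.
Proof.
apply/eqP; rewrite cards_eq0; apply/eqP/setP => p; rewrite !inE !perm1.
by lia.
Qed.

(** Without descents [w] is increasing, hence [x <= w x] everywhere; as [x] and [w x] have the same
    sum over all positions, each inequality is an equality. *)
Lemma ascent_eq1 w : (forall k, ~~ descent k w) -> w = 1%g.
Proof.
move=> asc.
have step x y : (x.+1 = y :> nat) -> (w x < w y)%N.
  move=> xy; have kP : (x < n.-1)%N by have := ltn_ord y; lia.
  have := asc (Ordinal kP); rewrite /descent -leqNgt leq_eqVlt.
  have -> : lo (Ordinal kP) = x by apply: val_inj.
  have -> : hi (Ordinal kP) = y by apply: val_inj.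
  case: eqP => // /ord_inj /perm_inj /(congr1 val) /=; lia.
have ge m : forall x, x = m :> nat -> (x <= w x)%N.
  elim: m => [|m IHm] x xm; first by rewrite xm.
  have mP : (m < n)%N by have := ltn_ord x; lia.
  have := IHm (Ordinal mP) erefl; have := step (Ordinal mP) x.
  by rewrite /= xm => /(_ erefl); lia.
have h : (\sum_(x < n) x <= \sum_(x < n) w x
          ?= iff [forall x : 'I_n, x == w x :> nat])%N.
  by apply: leqif_sum => x _; split; first exact: ge.
have e : (\sum_(x < n) x = \sum_(x < n) w x)%N.
  exact: (reindex_inj (@perm_inj _ w)).
case: h => _; rewrite e eqxx => /esym/forallP fx.
by apply/permP => x; rewrite perm1; apply/val_inj/esym/eqP/fx.
Qed.

Lemma exists_descent w : w != 1%g -> exists k, descent k w.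
Proof.
move=> w1; apply/existsP; apply: contraNT w1; rewrite negb_exists.
by move/forallP/ascent_eq1 => ->.
Qed.

Lemma inv_prod_leq t : (inv (\prod_(k <- t) sgen k)%g <= size t)%N.
Proof.
elim: t => [|k t IHt]; first by rewrite big_nil inv1.
rewrite big_cons /=; set w := (\prod_(_ <- t) _)%g in IHt *.
have [dk|/inv_ascent -> //] := boolP (descent k w).
by have := inv_descent dk; lia.
Qed.

Lemma exists_word w :
  exists s, (\prod_(k <- s) sgen k)%g = w /\ size s = inv w.
Proof.
move: {2}(inv w) (erefl (inv w)) => m; elim: m w => [|m IHm] w.
  have [->|/exists_descent[k /inv_descent ->] //] := eqVneq w 1%g.
  by exists [::]; rewrite big_nil inv1.
have [->|/exists_descent[k dk]] := eqVneq w 1%g; first by rewrite inv1.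
rewrite (inv_descent dk) => -[im]; have [s [sw ss]] := IHm _ im.
by exists (k :: s); rewrite big_cons sw sgenMK /= ss.
Qed.

(** Each letter raises the inversion number by at most one, and [exists_word] attains this bound;
    minimality among all words thus becomes a condition on the length alone. *)
Lemma reduced_wordP w s :
  reduced_word w s <-> (\prod_(k <- s) sgen k)%g = w /\ size s = inv w.
Proof.
split=> -[sw smin]; split=> //.
  have [t [tw st]] := exists_word w; apply/eqP; rewrite eqn_leq -{1}st smin //.
  by rewrite -sw inv_prod_leq.
by move=> t tw; rewrite smin -tw inv_prod_leq.
Qed.

Lemma exists_reduced w : exists s, reduced_word w s.
Proof. by have [s ws] := exists_word w; exists s; apply/reduced_wordP. Qed.

Lemma reduced_word1 s : reduced_word 1%g s -> s = [::].
Proof. by case/reduced_wordP => _; rewrite inv1 => /size0nil. Qed.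

Lemma reduced_nil w : reduced_word w [::] -> w = 1%g.
Proof. by case; rewrite big_nil. Qed.

Lemma reduced_cons k w s : descent k w -> reduced_word (sgen k * w)%g s ->
  reduced_word w (k :: s).
Proof.
move=> dk /reduced_wordP[sw ss]; apply/reduced_wordP.
by rewrite big_cons sw sgenMK /= ss -inv_descent.
Qed.

Lemma reduced_consE k w s : reduced_word w (k :: s) ->
  descent k w /\ reduced_word (sgen k * w)%g s.
Proof.
case/reduced_wordP; rewrite big_cons /= => sw ss.
have sv : (\prod_(i <- s) sgen i)%g = (sgen k * w)%g by rewrite -sw sgenMK.
have dk : descent k w.
  apply: contraT => /inv_ascent; have := inv_prod_leq s.
  by rewrite sv; lia.
by split=> //; apply/reduced_wordP; split=> //; have := inv_descent dk; lia.
Qed.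

Lemma descent_far i j w : (i.+1 < j)%N || (j.+1 < i)%N ->
  descent j (sgen i * w) = descent j w.
Proof.
move=> ij; rewrite /descent !permM !tpermD //; apply/negP => /eqP/(congr1 val) /=;
  lia.
Qed.

(** Two adjacent descents mean that [w] reverses three consecutive positions, so the longest element
    on these positions can be stripped off one letter at a time. *)
Lemma descent_braid i j w : (i.+1 == j :> nat) || (j.+1 == i :> nat) ->
  descent i w -> descent j w ->
  descent j (sgen i * w) /\ descent i (sgen j * (sgen i * w)).
Proof.
rewrite /descent !permM => /orP[] /eqP ij.
  have e : lo j = hi i by apply: val_inj.
  rewrite e tpermR => d1 d2.
  have f1 : sgen i (hi j) = hi j.
    by rewrite tpermD //; apply/negP => /eqP/(congr1 val) /=; lia.
  have f2 : sgen j (lo i) = lo i.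
    by rewrite tpermD //; apply/negP => /eqP/(congr1 val) /=; lia.
  by rewrite f1 f2 /sgen e !tpermL f1; split=> //; apply: ltn_trans d1.
have e : lo i = hi j by apply: val_inj.
rewrite e => d1 d2.
have f1 : sgen i (lo j) = lo j.
  by rewrite tpermD //; apply/negP => /eqP/(congr1 val) /=; lia.
have f2 : sgen j (hi i) = hi i.
  by rewrite tpermD //; apply/negP => /eqP/(congr1 val) /=; lia.
rewrite /sgen in f1 f2 *; rewrite e in f1 f2 *; rewrite f1 f2 tpermL !tpermR f1.
by split; first exact: ltn_trans d2.
Qed.

(** Induction on the length. If the first letters differ, both are descents of [w]; each word is
    compared, by induction on its tail, with a reduced word starting with one side of the
    commutation or braid relation. *)
Lemma matsumoto (A : pzRingType) (z : 'I_n.-1 -> A) w s t :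
  (forall i j, (i.+1 == j :> nat) || (j.+1 == i :> nat) ->
     z i * z j * z i = z j * z i * z j) ->
  (forall i j, (i.+1 < j)%N || (j.+1 < i)%N -> z i * z j = z j * z i) ->
  reduced_word w s -> reduced_word w t ->
  \prod_(k <- s) z k = \prod_(k <- t) z k.
Proof.
move=> zbraid zcomm.
move: {2}(size s) (leqnn (size s)) => m; elim: m w s t => [|m IHm] w s t.
  rewrite leqn0 size_eq0 => /eqP-> /reduced_nil-> /reduced_word1->.
  by rewrite big_nil.
case: s => [|i s] sm ws wt.
  by move: wt; rewrite (reduced_nil ws) => /reduced_word1->.
case: t wt => [|j t] wt.
  by move: ws; rewrite (reduced_nil wt) => /reduced_word1.
have sizest : size (i :: s) = size (j :: t).
  by case/reduced_wordP: ws => _ ->; case/reduced_wordP: wt => _ ->.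
case/reduced_consE: ws => di ws; case/reduced_consE: wt => dj wt.
rewrite /= in sm sizest; case: sizest => sizest.
rewrite !big_cons; have [ij|ij] := eqVneq i j.
  by congr (_ * _); [rewrite ij | apply: IHm ws _; rewrite // ij].
have [far|near] := boolP ((i.+1 < j)%N || (j.+1 < i)%N).
  (* The common tail that makes [i :: j :: r] and [j :: i :: r] both reduced for [w]. *)
  have [r wr] := exists_reduced (sgen j * (sgen i * w))%g.
  rewrite (IHm _ s (j :: r) _ ws); first last.
  - by apply: reduced_cons; rewrite ?descent_far.
  - by [].
  have far' : (j.+1 < i)%N || (i.+1 < j)%N by rewrite orbC.
  rewrite (IHm _ t (i :: r) _ wt); first last.
  - apply: reduced_cons; rewrite ?(descent_far _ far') //.
    by rewrite mulgA sgen_comm // -mulgA.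
  - by rewrite -sizest.
  by rewrite !big_cons !mulrA zcomm.
have adj : (i.+1 == j :> nat) || (j.+1 == i :> nat).
  by move: ij near; rewrite -val_eqE /=; lia.
have adj' : (j.+1 == i :> nat) || (i.+1 == j :> nat) by rewrite orbC.
have [dji diji] := descent_braid adj di dj.
have [dij djij] := descent_braid adj' dj di.
(* Likewise [i :: j :: i :: r] and [j :: i :: j :: r] are both reduced for [w]. *)
have [r wr] := exists_reduced (sgen i * (sgen j * (sgen i * w)))%g.
rewrite (IHm _ s (j :: i :: r) _ ws); first last.
- by do 2!apply: reduced_cons => //.
- by [].
rewrite (IHm _ t (i :: j :: r) _ wt); first last.
- do 2!apply: reduced_cons => //.
  by have /(congr1 (mulg^~ w)) := sgen_braid adj; rewrite -!mulgA => <-.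
- by rewrite -sizest.
by rewrite !big_cons !mulrA zbraid.
Qed.

End Inversions.

(** * Linear partitions and Young subgroups encoded by sets of generators *)

Section LinearPartitions.
Variable n : nat.
Implicit Types (J K : {set 'I_n.-1}) (x y : 'I_n) (w v : 'S_n).
Implicit Types (P : {set {set 'I_n}}).

(** Connectedness in the path graph on the positions whose edges are the generators in [J]. *)
Definition linked J x y :=
  [forall k : 'I_n.-1, (minn x y <= k < maxn x y)%N ==> (k \in J)].

Lemma linkedP J x y :
  reflect (forall k : 'I_n.-1, (minn x y <= k < maxn x y)%N -> k \in J)
          (linked J x y).
Proof.
by apply: (iffP forallP) => h k; [apply/implyP | apply/implyP]; apply: h.
Qed.

Lemma linked_refl J x : linked J x x.
Proof. by apply/linkedP => k; lia. Qed.

Lemma linked_sym J x y : linked J x y = linked J y x.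
Proof. by rewrite /linked minnC maxnC. Qed.

Lemma linked_trans J y x z : linked J x y -> linked J y z -> linked J x z.
Proof.
move=> /linkedP xy /linkedP yz; apply/linkedP => k kxz.
have [h|h] := boolP (minn x y <= k < maxn x y)%N; first exact: xy.
by apply: yz; lia.
Qed.

Lemma linked_equiv J : {in [set: 'I_n] & &, equivalence_rel (linked J)}.
Proof.
move=> x y z _ _ _; split=> [|xy]; first exact: linked_refl.
apply/idP/idP; last exact: linked_trans.
by apply: linked_trans; rewrite linked_sym.
Qed.

Lemma linked_sub J K x y : J \subset K -> linked J x y -> linked K x y.
Proof.
move=> /subsetP JK /linkedP xy; apply/linkedP => k /xy; exact: JK.
Qed.

Lemma linked_lohi J k : linked J (lo k) (hi k) = (k \in J).
Proof.
apply/linkedP/idP => [|kJ i /= ik]; first by apply=> /=; lia.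
by have -> : i = k by apply: val_inj => /=; lia.
Qed.

Definition blocks J := equivalence_partition (linked J) [set: 'I_n].

Lemma blocks_partition J : partition (blocks J) [set: 'I_n].
Proof. exact: equivalence_partitionP (@linked_equiv J). Qed.

Lemma pblock_blocks J x y : (y \in pblock (blocks J) x) = linked J x y.
Proof.
by rewrite pblock_equivalence_partition ?inE //; apply: linked_equiv.
Qed.

Lemma blocksP J (Q : {set 'I_n} -> Prop) :
  (forall x, Q [set y | linked J x y]) <-> (forall B, B \in blocks J -> Q B).
Proof.
have e x : [set y in [set: 'I_n] | linked J x y] = [set y | linked J x y].
  by apply/setP => y; rewrite !inE.
split=> [h B /imsetP[x _ ->]|h x]; first by rewrite e.
by apply: h; apply/imsetP; exists x; rewrite ?inE ?e.
Qed.

Lemma linear_blocks J : linear_partition (blocks J).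
Proof.
rewrite /linear_partition blocks_partition; apply/forall_inP.
apply/blocksP => x; apply/forall_inP => y; rewrite inE => /linkedP xy.
apply/forall_inP => z; rewrite inE => /linkedP xz.
apply/forallP => p; apply/implyP => /andP[yp pz]; rewrite inE.
apply/linkedP => k kxp.
have [h|h] := boolP (minn x y <= k < maxn x y)%N; first exact: xy.
by apply: xz; lia.
Qed.

Lemma joined_pblock P k : partition P [set: 'I_n] ->
  joined P k = (hi k \in pblock P (lo k)).
Proof.
case/and3P => /eqP cP tP _; apply/idP/idP.
  by case/exists_inP => B BP /andP[lB hB]; rewrite (def_pblock tP BP lB).
move=> h; apply/exists_inP; exists (pblock P (lo k)).
  by rewrite pblock_mem // cP inE.
by rewrite h mem_pblock cP inE.
Qed.

Lemma joined_blocks J k : joined (blocks J) k = (k \in J).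
Proof.
by rewrite joined_pblock ?blocks_partition // pblock_blocks linked_lohi.
Qed.

(** Walking down from the larger position one joined generator at a time never leaves the block.
    Conversely a block is an interval, so it contains both ends of every generator in between. *)
Lemma linked_joined P x y : linear_partition P ->
  linked [set k | joined P k] x y = (y \in pblock P x).
Proof.
case/andP => pP /forall_inP iP; have [/eqP cP tP _] := and3P pP.
have Px z : z \in pblock P z by rewrite mem_pblock cP inE.
have pxP z : pblock P z \in P by rewrite pblock_mem // cP inE.
apply/idP/idP => [|yx].
  have up m : forall u v : 'I_n, v = m :> nat -> (u <= v)%N ->
      linked [set k | joined P k] u v -> pblock P u = pblock P v.
    elim: m => [|m IHm] u v vm uv.
      by have -> : u = v by apply: val_inj => /=; lia.
    have [->//|ne] := eqVneq u v.
    have {}uv : (u < v)%N by rewrite ltn_neqAle uv -val_eqE in ne *; rewrite ne.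
    move/linkedP => h; have mP : (m < n.-1)%N by have := ltn_ord v; lia.
    have ev : hi (Ordinal mP) = v by apply: val_inj.
    have := h (Ordinal mP); rewrite inE joined_pblock // ev => /(_ _) hv.
    rewrite (same_pblock tP (hv _)); last by move=> /=; lia.
    apply: IHm => //=; first by lia.
    by apply/linkedP => k /= hk; apply: h; lia.
  have [xy|/ltnW yx] := leqP x y => h.
    by rewrite (up _ _ _ erefl xy h).
  by rewrite -(up _ _ _ erefl yx) ?Px // linked_sym.
apply/linkedP => k hk; rewrite inE joined_pblock //.
have /forall_inP iB := iP _ (pxP x).
have mem (u t p : 'I_n) : u \in pblock P x -> t \in pblock P x ->
    (u <= p <= t)%N -> p \in pblock P x.
  by move=> ux vx; have /forall_inP/(_ _ vx)/forallP/(_ p)/implyP := iB _ ux.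
have [l h] : lo k \in pblock P x /\ hi k \in pblock P x.
  have [xy|yx'] := leqP x y.
    by split; apply: (mem x y) => //=; lia.
  by split; apply: (mem y x) => //=; lia.
by rewrite (same_pblock tP l).
Qed.

Lemma blocks_joined P : linear_partition P -> blocks [set k | joined P k] = P.
Proof.
move=> lP; have [pP _] := andP lP.
rewrite -[RHS](equivalence_partition_pblock pP) /blocks.
rewrite /equivalence_partition; apply: eq_imset => x.
by apply/setP => y; rewrite !inE linked_joined.
Qed.

Definition youngs J := [set w : 'S_n | [forall x, linked J x (w x)]].

Lemma youngsP J w : reflect (forall x, linked J x (w x)) (w \in youngs J).
Proof. by rewrite inE; apply: forallP. Qed.

(** A permutation mapping a finite block into itself maps it onto itself, so the setwise condition
    can be checked pointwise. *)
Lemma young_blocks J w : young (blocks J) w = (w \in youngs J).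
Proof.
apply/forall_inP/youngsP => [/blocksP h x|h].
  have /eqP/setP/(_ (w x)) := h x.
  by rewrite inE mem_imset ?inE ?linked_refl //; apply: perm_inj.
apply/blocksP => x; rewrite eqEcard card_imset ?leqnn ?andbT; last exact: perm_inj.
apply/subsetP => _ /imsetP[y + ->]; rewrite !inE => xy.
exact: linked_trans xy (h y).
Qed.

Lemma youngs1 J : 1%g \in youngs J.
Proof. by apply/youngsP => x; rewrite perm1 linked_refl. Qed.

Lemma youngsM J w v : w \in youngs J -> v \in youngs J -> (w * v)%g \in youngs J.
Proof.
move=> /youngsP hw /youngsP hv; apply/youngsP => x.
by rewrite permM; apply: linked_trans (hw x) (hv _).
Qed.

Lemma youngs_sub J K w : J \subset K -> w \in youngs J -> w \in youngs K.
Proof.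
by move=> JK /youngsP h; apply/youngsP => x; apply: linked_sub JK (h x).
Qed.

Lemma sgen_youngs J k : k \in J -> sgen k \in youngs J.
Proof.
rewrite -linked_lohi => lk; apply/youngsP => x; rewrite /sgen.
by case: tpermP => [->|->|_ _]; rewrite ?linked_refl // linked_sym.
Qed.

(** If [k] were not in [J], a block would end at [lo k], so [w] would keep [lo k] and [hi k] on
    their sides of this cut, in increasing order. *)
Lemma descent_youngs J k w : w \in youngs J -> descent k w -> k \in J.
Proof.
move=> /youngsP h; rewrite /descent => d; move: (h (lo k)) (h (hi k)).
move=> /linkedP hl /linkedP hh.
have [h1|h1] := boolP (minn (lo k) (w (lo k)) <= k < maxn (lo k) (w (lo k)))%N.
  exact: hl.
by apply: hh; move: h1 => /=; lia.
Qed.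

Lemma reduced_youngs J w s : reduced_word w s -> w \in youngs J ->
  all (mem J) s.
Proof.
elim: s w => [|k s IHs] w //= /reduced_consE[dk ws] wJ.
have kJ := descent_youngs wJ dk; rewrite kJ (IHs _ ws) //.
by rewrite youngsM // sgen_youngs.
Qed.

Definition Jindex := [set x : {set 'I_n.-1} * 'S_n | x.2 \in youngs x.1].

Definition blocks_pair (x : {set 'I_n.-1} * 'S_n) := (blocks x.1, x.2).

Lemma blocks_pair_inj : injective blocks_pair.
Proof.
move=> [J w] [K v] [eJ ->]; congr (_, _).
by apply/setP => k; rewrite -!joined_blocks eJ.
Qed.

Lemma GindexE : Gindex n = blocks_pair @: Jindex.
Proof.
apply/setP => -[P w]; rewrite !inE /=; apply/andP/imsetP.
  case=> lP yP; exists ([set k | joined P k], w); last first.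
    by rewrite /blocks_pair blocks_joined.
  by rewrite inE /= -young_blocks blocks_joined.
case=> -[J v]; rewrite inE /= => vJ [-> ->].
by rewrite linear_blocks young_blocks.
Qed.

Lemma Gindex_sum (V : nmodType) (F : {set {set 'I_n}} * 'S_n -> V) :
  \sum_(Iw in Gindex n) F Iw = \sum_(x in Jindex) F (blocks_pair x).
Proof.
by rewrite GindexE big_imset //= => x y _ _; apply: blocks_pair_inj.
Qed.

End LinearPartitions.

(** * Spanning: left multiplication of the basis by the generators *)

Section Spanning.
Variables (n : nat) (R : comNzRingType) (c : R) (rw : 'S_n -> seq 'I_n.-1).
Hypothesis rwP : forall w, reduced_word w (rw w).
Local Notation index := ({set 'I_n.-1} * 'S_n)%type.

Definition basis_elt (A : algType R) (e z : 'I_n.-1 -> A) (x : index) : A :=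
  \prod_(k in x.1) e k * z_of z (rw x.2).

Section Relations.
Variables (A : algType R) (e z : 'I_n.-1 -> A).
Hypothesis ez : bH_relations c e z.

Lemma e_prod_setU1 (J : {set 'I_n.-1}) k :
  e k * \prod_(i in J) e i = \prod_(i in k |: J) e i.
Proof.
have [ee [eC _]] := ez.
(* Induction along the index list: [e k] commutes past the factors before position [k], where it is
   inserted or absorbed by idempotence. *)
have main : forall s : seq 'I_n.-1, uniq s -> k \in s ->
    e k * \prod_(i <- s | i \in J) e i = \prod_(i <- s | i \in k |: J) e i.
  elim=> // a s IHs /= /andP[as_ us]; rewrite inE !big_cons in_setU1 => /orP[].
    move/eqP=> ->; rewrite eqxx /=.
    have -> : \prod_(i <- s | i \in a |: J) e i = \prod_(i <- s | i \in J) e i.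
      rewrite big_seq_cond [RHS]big_seq_cond; apply: eq_bigl => i.
      rewrite in_setU1; have [is_|//] := boolP (i \in s).
      by have -> : (i == a) = false by apply/negbTE; apply: contraTneq is_ => ->.
    by case: ifP => // _; rewrite mulrA ee.
  move=> ks; rewrite -IHs //.
  have -> : (a == k) = false by apply: contraNF as_ => /eqP->.
  by case: ifP => //= _; rewrite !mulrA eC.
by apply: main; rewrite ?index_enum_uniq ?mem_index_enum.
Qed.

Lemma z_prod_comm (J : {set 'I_n.-1}) k :
  z k * \prod_(i in J) e i = \prod_(i in J) e i * z k.
Proof.
have [_ [_ [_ [_ [_ [ezC _]]]]]] := ez.
apply: (big_rec (fun x => z k * x = x * z k)) => [|i x _ IHx].
  by rewrite mulr1 mul1r.
by rewrite mulrA -ezC -!mulrA IHx.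
Qed.

Lemma z_of_reduced w s : reduced_word w s -> z_of z (rw w) = z_of z s.
Proof.
have [_ [_ [zb [zc _]]]] := ez.
by move=> ws; apply: (matsumoto zb zc (rwP w) ws).
Qed.

Lemma basis_elt1 : basis_elt e z (set0, 1%g) = 1.
Proof.
rewrite /basis_elt big_pred0 => [|i]; last by rewrite inE.
by rewrite (reduced_word1 (rwP 1%g)) /z_of big_nil mulr1.
Qed.

Lemma e_basis_elt k J w : e k * basis_elt e z (J, w) = basis_elt e z (k |: J, w).
Proof. by rewrite /basis_elt mulrA e_prod_setU1. Qed.

Lemma e_prodC (J : {set 'I_n.-1}) k :
  \prod_(i in J) e i * e k = e k * \prod_(i in J) e i.
Proof.
have [_ [eC _]] := ez.
apply: (big_rec (fun x => x * e k = e k * x)) => [|i x _ IHx].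
  by rewrite mulr1 mul1r.
by rewrite mulrA eC -!mulrA IHx.
Qed.

(** Since [z k = e k * z k], moving [z k] past the central product leaves an [e k] behind. *)
Lemma z_e_prod (J : {set 'I_n.-1}) k (x : A) :
  z k * (\prod_(i in J) e i * x) = \prod_(i in k |: J) e i * (z k * x).
Proof.
have [_ [_ [_ [_ [ez1 _]]]]] := ez.
rewrite -e_prod_setU1 -mulrA (mulrA _ (z k)) -z_prod_comm -mulrA.
by rewrite [RHS]mulrA ez1.
Qed.

Lemma z_basis_elt_ascent k J w : ~~ descent k w ->
  z k * basis_elt e z (J, w) = basis_elt e z (k |: J, (sgen k * w)%g).
Proof.
move=> asc; rewrite /basis_elt z_e_prod; congr (_ * _).
rewrite (@z_of_reduced (sgen k * w)%g (k :: rw w)) /z_of ?big_cons //.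
by apply: reduced_cons; rewrite ?sgenMK ?descent_sgen.
Qed.

(** Here [z_w] begins with [z k], and the quadratic relation rewrites the resulting square; its
    [e k] is absorbed because [k |: J] already contains [k]. *)
Lemma z_basis_elt_descent k J w : descent k w ->
  z k * basis_elt e z (J, w) =
    basis_elt e z (k |: J, (sgen k * w)%g) + c *: basis_elt e z (k |: J, w).
Proof.
have [_ [_ [_ [_ [_ [_ zz]]]]]] := ez.
move=> des; rewrite /basis_elt z_e_prod.
have zw : z_of z (rw w) = z k * z_of z (rw (sgen k * w)%g).
  by rewrite (@z_of_reduced w (k :: rw (sgen k * w)%g)) /z_of ?big_cons //;
     apply: reduced_cons.
rewrite zw [z k * (z k * _)]mulrA zz mulrDl mulrDr -scalerAl -scalerAr.
rewrite [_ * (e k * _)]mulrA e_prodC.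
by rewrite e_prod_setU1 setUA setUid.
Qed.

End Relations.

(** The coefficients are chosen before the algebra, so this is an identity in the universal algebra,
    stated without constructing it. *)
Definition spans (F : forall A : algType R, ('I_n.-1 -> A) -> ('I_n.-1 -> A) -> A) :=
  exists a : index -> R, forall (A : algType R) (e z : 'I_n.-1 -> A),
    bH_relations c e z ->
    F A e z = \sum_(x in Jindex n) a x *: basis_elt e z x.

Lemma spans_basis_elt x : x \in Jindex n -> spans (fun A e z => basis_elt e z x).
Proof.
move=> xJ; exists (fun y => (y == x)%:R) => A e z _.
rewrite (bigD1 x) //= eqxx scale1r big1 ?addr0 // => y /andP[_ /negPf ->].
by rewrite scale0r.
Qed.

Lemma spansD F1 F2 : spans F1 -> spans F2 ->
  spans (fun A e z => F1 A e z + F2 A e z).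
Proof.
move=> [a ha] [b hb]; exists (fun x => a x + b x) => A e z ez.
rewrite ha // hb // -big_split; apply: eq_bigr => x _ /=.
by rewrite scalerDl.
Qed.

Lemma spansZ d F : spans F -> spans (fun A e z => d *: F A e z).
Proof.
move=> [a ha]; exists (fun x => d * a x) => A e z ez.
rewrite ha // scaler_sumr; apply: eq_bigr => x _.
by rewrite scalerA.
Qed.

Lemma eq_spans F1 F2 :
  (forall (A : algType R) (e z : 'I_n.-1 -> A), bH_relations c e z ->
     F1 A e z = F2 A e z) -> spans F2 -> spans F1.
Proof. by move=> eF [a ha]; exists a => A e z ez; rewrite eF ?ha. Qed.

Lemma spans_mull (g : forall A : algType R, ('I_n.-1 -> A) -> ('I_n.-1 -> A) -> A) F :
  (forall x, x \in Jindex n -> spans (fun A e z => g A e z * basis_elt e z x)) ->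
  spans F -> spans (fun A e z => g A e z * F A e z).
Proof.
move=> hg [a ha].
(* Finite choice of the coefficients of all products; the membership premise sits under the
   existential so that zero can serve as default outside [Jindex n]. *)
have /fin_all_exists[b hb] : forall x : index, exists b : index -> R,
    x \in Jindex n -> forall (A : algType R) (e z : 'I_n.-1 -> A),
    bH_relations c e z -> g A e z * basis_elt e z x =
      \sum_(y in Jindex n) b y *: basis_elt e z y.
  move=> x; have [xJ|_] := boolP (x \in Jindex n); last by exists (fun=> 0).
  by have [b hb] := hg _ xJ; exists b.
exists (fun y => \sum_(x in Jindex n) a x * b x y) => A e z ez.
rewrite ha // mulr_sumr.
under eq_bigr => x xJ do rewrite -scalerAr hb // scaler_sumr.
rewrite exchange_big; apply: eq_bigr => y _ /=.
by rewrite scaler_suml; apply: eq_bigr => x _; rewrite scalerA.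
Qed.

(** The span contains 1, as the basis element at [(set0, 1)], and is stable under left
    multiplication by each generator. *)
Lemma spans_eval_word u : spans (fun A e z => eval_word e z u).
Proof.
have JU k (J : {set 'I_n.-1}) w : w \in youngs J -> w \in youngs (k |: J).
  by apply: youngs_sub; apply: subsetUr.
elim: u => [|g u IHu].
  apply: (@eq_spans _ (fun A e z => basis_elt e z (set0, 1%g))).
    by move=> A e z ez; rewrite basis_elt1 /eval_word big_nil.
  by apply: spans_basis_elt; rewrite inE youngs1.
apply: (@eq_spans _ (fun A e z =>
    (match g with GenE i => e i | GenZ i => z i end) * eval_word e z u)).
  by move=> A e z _; rewrite /eval_word big_cons.
apply: (@spans_mull (fun A e z => match g with GenE i => e i | GenZ i => z i end)).
  move=> [J w]; rewrite inE /= => wJ; case: g => k.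
    apply: (@eq_spans _ (fun A e z => basis_elt e z (k |: J, w))).
      by move=> A e z ez; rewrite (e_basis_elt ez).
    by apply: spans_basis_elt; rewrite inE JU.
  have swJ : (k |: J, (sgen k * w)%g) \in Jindex n.
    by rewrite inE; apply: youngsM (JU _ _ _ wJ); rewrite sgen_youngs ?setU11.
  have [des|asc] := boolP (descent k w).
    apply: (@eq_spans _ (fun A e z => basis_elt e z (k |: J, (sgen k * w)%g)
        + c *: basis_elt e z (k |: J, w))).
      by move=> A e z ez; rewrite (z_basis_elt_descent ez).
    apply: spansD; first exact: spans_basis_elt.
    by apply/spansZ/spans_basis_elt; rewrite inE JU.
  apply: (@eq_spans _ (fun A e z => basis_elt e z (k |: J, (sgen k * w)%g))).
    by move=> A e z ez; rewrite (z_basis_elt_ascent ez).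
  exact: spans_basis_elt.
exact: IHu.
Qed.

End Spanning.

(** * The regular representation of the Hecke algebra of the symmetric group *)

Section HeckeRepresentation.
Variables (n : nat) (R : comNzRingType) (c : R).

(** The size is written as a successor so that the square matrices form a nonzero ring. *)
Local Notation N := #|{: 'S_n}|.-1.+1.

Lemma card_perm_pred : N = #|{: 'S_n}|.
Proof. by rewrite prednK //; apply/card_gt0P; exists 1%g. Qed.

Definition perm_at (a : 'I_N) : 'S_n := enum_val (cast_ord card_perm_pred a).
Definition perm_idx (w : 'S_n) : 'I_N :=
  cast_ord (esym card_perm_pred) (enum_rank w).

Lemma perm_idxK w : perm_at (perm_idx w) = w.
Proof. by rewrite /perm_at /perm_idx cast_ordKV enum_rankK. Qed.

Lemma perm_atK a : perm_idx (perm_at a) = a.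
Proof. by rewrite /perm_at /perm_idx enum_valK cast_ordK. Qed.

(* Left multiplication by [T_k] in the Iwahori-Hecke algebra, on coordinate
   functions: [(T_k f)(w) = f(s_k w) + c [descent k w] f(w)]. *)
Definition hecke_mx (k : 'I_n.-1) : 'M[R]_N :=
  \matrix_(a, b) ((perm_at b == sgen k * perm_at a)%g%:R
                  + c * (descent k (perm_at a) && (b == a))%:R).

Definition act_idx k a := perm_idx (sgen k * perm_at a)%g.

Lemma hecke_mxE k m (X : 'M[R]_(N, m)) a j :
  (hecke_mx k *m X) a j =
    X (act_idx k a) j + c * (descent k (perm_at a))%:R * X a j.
Proof.
rewrite mxE (eq_bigr (fun b => (b == act_idx k a)%:R * X b j +
    c * (descent k (perm_at a))%:R * ((b == a)%:R * X b j))); last first.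
  move=> b _; rewrite mxE mulrDl; congr (_%:R * _ + _).
    by rewrite -(inj_eq (can_inj perm_atK)) /act_idx perm_idxK.
  by case: (descent _ _); rewrite /= ?mulr0 ?mul0r ?mulr1 ?mulrA.
rewrite big_split -mulr_sumr /=; congr (_ + _ * _).
  rewrite (bigD1 (act_idx k a)) //= eqxx mul1r big1 ?addr0 // => b /negPf ->.
  by rewrite mul0r.
rewrite (bigD1 a) //= eqxx mul1r big1 ?addr0 // => b /negPf ->.
by rewrite mul0r.
Qed.

Lemma perm_at_act k a : perm_at (act_idx k a) = (sgen k * perm_at a)%g.
Proof. exact: perm_idxK. Qed.

Lemma act_idxK k a : act_idx k (act_idx k a) = a.
Proof. by rewrite /act_idx perm_idxK sgenMK perm_atK. Qed.

(** Exactly one of [w] and [sgen k * w] has a descent at [k], so the two cross terms add up to a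
    single [c] times [f (sgen k * w)]. *)
Lemma hecke_quadratic k : hecke_mx k *m hecke_mx k = 1%:M + c *: hecke_mx k.
Proof.
(* The identity matrix is appended so that every factor acts on something and [hecke_mxE]
   applies. *)
rewrite -[X in _ *m X]mulmx1 -[X in _ + c *: X]mulmx1.
apply/matrixP => a j; rewrite hecke_mxE [RHS]mxE [X in _ = _ + X]mxE !hecke_mxE.
rewrite act_idxK perm_at_act descent_sgen.
by case: (descent k _) => /=; ring.
Qed.

Lemma hecke_comm (i j : 'I_n.-1) : (i.+1 < j)%N || (j.+1 < i)%N ->
  hecke_mx i *m hecke_mx j = hecke_mx j *m hecke_mx i.
Proof.
move=> ij; have ji : (j.+1 < i)%N || (i.+1 < j)%N by rewrite orbC.
rewrite -[X in _ *m X = _]mulmx1 -[X in _ = _ *m X]mulmx1.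
apply/matrixP => a l; rewrite !hecke_mxE !perm_at_act !descent_far //.
have -> : act_idx j (act_idx i a) = act_idx i (act_idx j a).
  by rewrite /act_idx !perm_idxK !mulgA sgen_comm.
by ring.
Qed.

(** All descents involved compare the values of [w] at the three positions moved by [i] and [j], so
    a check of their relative orders suffices. *)
Lemma hecke_braid (i j : 'I_n.-1) : (i.+1 == j :> nat) || (j.+1 == i :> nat) ->
  hecke_mx i *m hecke_mx j *m hecke_mx i = hecke_mx j *m hecke_mx i *m hecke_mx j.
Proof.
wlog ij : i j / i.+1 = j => [hw|_].
  by case/orP => /eqP ij; [|apply/esym]; apply: hw; rewrite ?ij ?eqxx.
have adj : (i.+1 == j :> nat) || (j.+1 == i :> nat) by rewrite ij eqxx.
rewrite -!mulmxA -[X in _ *m (_ *m X) = _]mulmx1 -[X in _ = _ *m (_ *m X)]mulmx1.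
apply/matrixP => a l; rewrite !hecke_mxE !perm_at_act.
have -> : act_idx i (act_idx j (act_idx i a)) =
          act_idx j (act_idx i (act_idx j a)).
  by rewrite /act_idx !perm_idxK !mulgA -(mulgA (sgen i)) sgen_braid // mulgA.
rewrite !act_idxK /descent !permM.
have e : lo j = hi i by apply: val_inj.
have f1 : sgen i (hi j) = hi j.
  by rewrite tpermD //; apply/negP => /eqP/(congr1 val) /=; lia.
have f2 : sgen j (lo i) = lo i.
  by rewrite tpermD //; apply/negP => /eqP/(congr1 val) /=; lia.
rewrite /sgen e in f1 f2 *; rewrite !(tpermL, tpermR, f1, f2).
set w := perm_at a.
have ne u v : u != v -> (w u == w v :> nat) = false.
  by move=> /negPf uv; rewrite val_eqE (inj_eq perm_inj).
have := ne (lo i) (hi i); have := ne (lo i) (hi j); have := ne (hi i) (hi j).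
rewrite -!val_eqE /= => /(_ _) n1 /(_ _) n2 /(_ _) n3.
(* Ties and cyclic orders are contradictory; each genuine order leaves a polynomial identity in
   [c]. *)
case: (ltngtP (w (lo i)) (w (hi i))) => h1;
  case: (ltngtP (w (lo i)) (w (hi j))) => h2;
  case: (ltngtP (w (hi i)) (w (hi j))) => h3; try lia; rewrite /=; ring.
Qed.

End HeckeRepresentation.

(** * Linear independence through the parabolic representations *)

Section Independence.
Variables (n : nat) (R : comNzRingType) (c : R) (rw : 'S_n -> seq 'I_n.-1).
Hypothesis rwP : forall w, reduced_word w (rw w).
Local Notation N := #|{: 'S_n}|.-1.+1.

Section Parabolic.
Variable J : {set 'I_n.-1}.

(** Once [e k] acts as zero, the relation [e k * z k = z k] forces [z k] to vanish as well. *)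
Definition parabolic_e (k : 'I_n.-1) : 'M[R]_N := (k \in J)%:R.
Definition parabolic_z (k : 'I_n.-1) : 'M[R]_N :=
  if k \in J then hecke_mx c k else 0.

Lemma parabolic_relations : bH_relations c parabolic_e parabolic_z.
Proof.
rewrite /parabolic_e /parabolic_z; split=> [i|].
  by case: (i \in J); rewrite ?mulr1 ?mul0r.
split=> [i j|]; first by do 2 case: (_ \in J); rewrite ?mulr1 ?mul1r ?mul0r.
split=> [i j ij|].
  case: (i \in J); case: (j \in J); rewrite ?mul0r ?mulr0 ?mul0r //.
  exact: hecke_braid.
split=> [i j ij|].
  case: (i \in J); case: (j \in J); rewrite ?mul0r ?mulr0 //.
  exact: hecke_comm.
split=> [i|]; first by case: (i \in J); rewrite ?mul1r ?mul0r.
split=> [i j|]; first by case: (i \in J); rewrite ?mulr1 ?mul1r ?mulr0 ?mul0r.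
move=> i; case: (i \in J); last by rewrite mul0r scaler0 addr0.
exact: hecke_quadratic.
Qed.

Lemma parabolic_e_prod (K : {set 'I_n.-1}) :
  \prod_(k in K) parabolic_e k = (K \subset J)%:R.
Proof.
have [/subsetP KJ|/subsetPn[k kK kJ]] := boolP (K \subset J).
  by rewrite big1 // => k /KJ kJ; rewrite /parabolic_e kJ.
have k_in : k \in index_enum 'I_n.-1 by apply: mem_index_enum.
elim: (index_enum _) k_in => //= a s IHs; rewrite inE big_cons => /orP[/eqP<-|/IHs->].
  by rewrite kK /parabolic_e (negPf kJ) mul0r.
by rewrite mulr0 if_same.
Qed.

Definition perm_col (w : 'S_n) : 'cV[R]_N := \col_a (perm_at a == w)%:R.

(** The vector [perm_col w] is the basis vector [T_w]; the [c] term of [hecke_mxE] could only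
    contribute at [w], where [k] is an ascent. *)
Lemma hecke_perm_col k w : ~~ descent k w ->
  hecke_mx c k *m perm_col w = perm_col (sgen k * w)%g.
Proof.
move=> asc; apply/matrixP => a j; rewrite hecke_mxE !mxE perm_at_act.
have -> : (sgen k * perm_at a == w)%g = (perm_at a == sgen k * w)%g.
  by rewrite -(inj_eq (mulgI (sgen k))) sgenMK.
have [aw|_] := eqVneq (perm_at a) w; last by rewrite mulr0 addr0.
by rewrite aw (negPf asc) mulr0 mul0r addr0.
Qed.

Lemma z_of_perm_col w s : reduced_word w s -> all (mem J) s ->
  z_of parabolic_z s *m perm_col 1%g = perm_col w.
Proof.
elim: s w => [|k s IHs] w.
  by move=> /reduced_nil-> _; rewrite /z_of big_nil mul1mx.
case/reduced_consE => des ws /= /andP[kJ sJ].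
rewrite /z_of big_cons -mulmxA (IHs _ ws sJ) /parabolic_z kJ.
by rewrite hecke_perm_col ?sgenMK // descent_sgen des.
Qed.

End Parabolic.

Lemma basis_elt_free (a : {set 'I_n.-1} * 'S_n -> R) :
  (forall (A : algType R) (e z : 'I_n.-1 -> A), bH_relations c e z ->
     \sum_(x in Jindex n) a x *: basis_elt rw e z x = 0) ->
  forall x, x \in Jindex n -> a x = 0.
Proof.
move=> a0 [J w]; move: {2}#|J|.+1 (ltnSn #|J|) => m.
elim: m J w => // m IHm J w Jm wJ.
(* The relation is evaluated in the representation of [J], applied to [T_1], and read at the
   coordinate of [w]. *)
have /(congr1 (fun M => (M *m perm_col 1%g) (perm_idx w) 0)) :=
  a0 _ _ _ (parabolic_relations J).
rewrite mul0mx [RHS]mxE mulmx_suml summxE (bigD1 (J, w)) //= big1 ?addr0.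
  rewrite /basis_elt parabolic_e_prod subxx mul1r -scalemxAl.
  rewrite (z_of_perm_col (rwP w)) ?mxE; last first.
    by apply: reduced_youngs (rwP w) _; move: wJ; rewrite inE.
  by rewrite perm_idxK eqxx mulr1.
move=> [K v] /andP[vK ne]; rewrite /basis_elt parabolic_e_prod /=.
(* Three kinds of other terms: [K] outside [J] acts by zero, a proper subset has coefficient zero by
   induction, and [K = J] gives a multiple of [T_v] with [v] distinct from [w]. *)
have [KJ|_] := boolP (K \subset J); last by rewrite mul0r scaler0 mul0mx mxE.
have [eKJ|KneJ] := eqVneq K J; last first.
  have Km : (#|K| < m)%N.
    by apply: leq_trans (proper_card _) Jm; rewrite properEneq KneJ.
  by rewrite IHm // scale0r mul0mx mxE.
rewrite mul1r -scalemxAl (z_of_perm_col (rwP v)); last first.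
  by apply: reduced_youngs (rwP v) _; move: vK; rewrite inE eKJ.
rewrite !mxE perm_idxK; have [wv|_] := eqVneq w v; last by rewrite mulr0.
by move: ne; rewrite eKJ wv eqxx.
Qed.

End Independence.

(** * Compositions and the orders of Young subgroups *)

Section Cardinality.

(* [runs 1 b] is the composition of [(size b).+1] cut at the [false] entries
   of [b]; [m] is the length of the block being read. *)
Fixpoint runs (m : nat) (b : seq bool) : seq nat :=
  if b is d :: b' then if d then runs m.+1 b' else m :: runs 1 b' else [:: m].

(** Decodes [runs]: every part opens with a [false]. The one opening the first part is no cut, so
    [behead] removes it in the inverse of [runs 1]. *)
Definition run_word (s : seq nat) : seq bool :=
  flatten [seq false :: nseq m.-1 true | m <- s].

Lemma run_word_runs m b : (0 < m)%N ->
  run_word (runs m b) = false :: nseq m.-1 true ++ b.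
Proof.
elim: b m => [|[] b IHb] [|m] //= _; rewrite /run_word /= ?cats0 //.
  by rewrite -/(run_word _) IHb //=; congr (_ :: _); elim: m => //= m ->.
by rewrite -/(run_word _) IHb.
Qed.

Lemma runs_cat_nseq m p b : runs m (nseq p true ++ b) = runs (m + p) b.
Proof.
by elim: p m => [|p IHp] m /=; rewrite ?addn0 // IHp addSnnS.
Qed.

Lemma runs_run_word m s : all (fun p => 0 < p)%N s ->
  runs m (run_word s) = m :: s.
Proof.
elim: s m => [|p s IHs] m //= /andP[p0 s0].
by rewrite runs_cat_nseq add1n prednK // IHs.
Qed.

Lemma size_run_word s : all (fun p => 0 < p)%N s -> size (run_word s) = sumn s.
Proof.
elim: s => //= p s IHs /andP[p0 /IHs].
by rewrite /run_word /= size_cat size_nseq => ->; lia.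
Qed.

Lemma runs_gt0 m b : (0 < m)%N -> all (fun p => 0 < p)%N (runs m b).
Proof. by elim: b m => [|[] b IHb] m /= m0; rewrite ?m0 ?IHb. Qed.

Lemma runs_inj : injective (runs 1).
Proof.
by move=> b b' /(congr1 (behead \o run_word)); rewrite /= !run_word_runs.
Qed.

Lemma sumn_runs m b : (0 < m)%N -> sumn (runs m b) = (m + size b)%N.
Proof.
move=> m0; rewrite -size_run_word ?runs_gt0 // run_word_runs //=.
by rewrite size_cat size_nseq; lia.
Qed.

Lemma perm_compositions n (l : seq (seq nat)) : uniq l ->
  (forall s, (s \in l) = all (fun m => 0 < m)%N s && (sumn s == n.+1)) ->
  perm_eq l [seq runs 1 (val b) | b <- enum {: n.-tuple bool}].
Proof.
move=> ul lP; apply: uniq_perm => // [|s].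
  by rewrite map_inj_uniq ?enum_uniq // => b b' /runs_inj /val_inj.
rewrite lP; apply/andP/mapP => [[s0 /eqP sn]|[b _ ->]]; last first.
  by rewrite runs_gt0 // sumn_runs // size_tuple.
have sz : size (behead (run_word s)) == n.
  by rewrite size_behead size_run_word // sn.
exists (Tuple sz); rewrite ?mem_enum //=.
case: s s0 {sn sz} (sn) => [|p s] //= /andP[p0 s0] _.
by rewrite runs_cat_nseq add1n prednK // runs_run_word.
Qed.

Section Youngs.
Variables (n : nat) (J : {set 'I_n.+1.-1}).
Implicit Types (x y : 'I_n.+1) (w : 'S_n.+1) (m : nat).

(** The chain of subgroups for orbit-stabilizer: trivial at [m = 0], all of [youngs J] at
    [m = n.+1]. *)
Definition young_below m : {set 'S_n.+1} :=
  [set w in youngs J | [forall x : 'I_n.+1, (m <= x)%N ==> (w x == x)]].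

Lemma young_belowP m w :
  reflect (w \in youngs J /\ forall x, (m <= x)%N -> w x = x) (w \in young_below m).
Proof.
rewrite [X in reflect _ X]in_set; apply: (iffP andP) => -[wJ h]; split=> //.
  by move=> x mx; have /forallP/(_ x) := h; rewrite mx => /eqP.
by apply/forallP => x; apply/implyP => /h ->.
Qed.

Lemma young_below_group_set m : group_set (young_below m).
Proof.
apply/group_setP; split=> [|w v /young_belowP[wJ w1] /young_belowP[vJ v1]].
  by apply/young_belowP; split=> [|x _]; rewrite ?youngs1 ?perm1.
by apply/young_belowP; split=> [|x mx]; rewrite ?youngsM // permM w1 ?v1.
Qed.
Canonical young_below_group m := group (young_below_group_set m).

(** The place of [x] inside its block, counted from 1. *)
Definition rank x := #|[set y : 'I_n.+1 | (y <= x)%N && linked J x y]|.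

(** Positions above [x] are fixed, so by injectivity [x] cannot move up; each linked [y] below it is
    reached by [tperm x y]. *)
Lemma orbit_young_below x :
  orbit 'P (young_below x.+1) x = [set y : 'I_n.+1 | (y <= x)%N && linked J x y].
Proof.
apply/setP => y; rewrite inE; apply/orbitP/andP => [[w]|[yx xy]].
  move=> /young_belowP[/youngsP wJ w1] <- /=; rewrite apermE; split=> //.
  rewrite leqNgt; apply/negP => xw; have := w1 _ xw => /perm_inj wx.
  by move: xw; rewrite wx ltnn.
exists (tperm x y); last by rewrite /= apermE tpermL.
apply/young_belowP; split=> [|z xz].
  apply/youngsP => z; case: tpermP => [->//|->|_ _]; last exact: linked_refl.
  by rewrite linked_sym.
rewrite tpermD //; apply/negP => /eqP/(congr1 val) /=; lia.
Qed.

Lemma stab_young_below x :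
  ('C_(young_below x.+1)[x | 'P] = young_below x)%g.
Proof.
apply/setP => w; apply/setIP/young_belowP => [[/young_belowP[wJ w1] /astab1P wx]|].
  split=> // y; rewrite leq_eqVlt => /orP[/eqP/val_inj <-|/w1 //].
  by move: wx; rewrite /= apermE.
case=> wJ w1; split; last by apply/astab1P; rewrite /= apermE w1.
by apply/young_belowP; split=> // y /ltnW/w1.
Qed.

Lemma card_young_below x :
  #|young_below x.+1| = (rank x * #|young_below x|)%N.
Proof. by rewrite -(card_orbit_stab 'P _ x) orbit_young_below stab_young_below. Qed.

Lemma rank0 : rank ord0 = 1%N.
Proof.
rewrite /rank (_ : [set y | _] = [set ord0]) ?cards1 //.
apply/setP => y; rewrite !inE leqn0 -val_eqE /=.
case: eqP => //= y0; have -> : y = ord0 by apply: val_inj.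
by rewrite linked_refl.
Qed.

Lemma rank_hi k : rank (hi k) = if k \in J then (rank (lo k)).+1 else 1%N.
Proof.
rewrite /rank -linked_lohi; case: ifP => lk.
  rewrite (cardsD1 (hi k)) inE leqnn linked_refl add1n; congr _.+1.
  apply: eq_card => y; rewrite !inE -val_eqE /=.
  have -> : linked J (hi k) y = linked J (lo k) y.
    have [] := @linked_equiv _ J (lo k) (hi k) y; rewrite ?inE // => _ h.
    by rewrite h.
  by rewrite andbA; congr (_ && _); lia.
rewrite (_ : [set y | _] = [set hi k]) ?cards1 //.
apply/setP => y; rewrite !inE; apply/andP/eqP => [[yk hy]|->]; last first.
  by rewrite leqnn linked_refl.
apply/eqP; apply: contraFT lk => ne; apply/linkedP => i /= hi_i.
have /linkedP := hy; apply; move: ne yk; rewrite -val_eqE /=; lia.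
Qed.

Definition link_word : seq bool := [seq k \in J | k <- enum 'I_n.+1.-1].

Lemma card_youngs :
  #|youngs J| = \prod_(m <- runs 1 link_word) m`!.
Proof.
have size_w : size link_word = n by rewrite size_map size_enum_ord.
(* Downward induction on [x], with [m] the distance to the last position. The block of [x] is still
   open: [young_below x] accounts for [(rank x).-1] of its positions, whence the extra factorial on
   the right. *)
suff main m x : (x + m)%N = n ->
    (#|young_below x| * \prod_(p <- runs (rank x) (drop x link_word)) p`!)%N
     = (#|youngs J| * (rank x).-1`!)%N.
  have := main n ord0 erefl; rewrite drop0 rank0 muln1 => <-.
  suff -> : young_below (ord0 : 'I_n.+1) = [set 1%g] by rewrite cards1 mul1n.
  apply/setP => w; apply/young_belowP/set1P => [[_ w1]|->].
    by apply/permP => x; rewrite w1 ?perm1.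
  by split=> [|x _]; rewrite ?youngs1 ?perm1.
have rank_gt0 y : (0 < rank y)%N.
  by apply/card_gt0P; exists y; rewrite inE leqnn linked_refl.
elim: m x => [|m IHm] x xm.
  have xn : x = n :> nat by lia.
  rewrite drop_oversize /= ?big_seq1; last by rewrite size_w xn.
  have -> : youngs J = young_below x.+1.
    apply/setP => w; apply/idP/young_belowP => [wJ|[]//]; split=> // y.
    by rewrite xn => /(leq_trans (ltn_ord y)); rewrite ltnn.
  rewrite card_young_below -[in LHS](prednK (rank_gt0 x)) factS prednK //.
  by rewrite mulnCA mulnA.
have kP : (x < n.+1.-1)%N by rewrite /=; lia.
pose k : 'I_n.+1.-1 := Ordinal kP.
have lok : lo k = x by apply: val_inj.
have hik : hi k = x.+1 :> nat by [].
have IH : (hi k + m)%N = n by rewrite hik; lia.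
move/IHm: IH; rewrite hik => IH.
rewrite (drop_nth false) ?size_w //=.
have -> : nth false link_word x = (k \in J).
  rewrite (nth_map k) ?size_enum_ord //; congr (_ \in J).
  by apply: val_inj; rewrite /= nth_enum_ord.
move: IH; rewrite rank_hi lok card_young_below.
(* If [k] is in [J] the open block grows and the factor [rank x] cancels; otherwise it closes with
   [rank x] elements and a block of rank 1 opens. *)
case: (k \in J) => /= IH.
  apply/eqP; rewrite -(eqn_pmul2l (rank_gt0 x)); apply/eqP.
  rewrite mulnA IH -[in LHS](prednK (rank_gt0 x)) factS prednK //.
  by rewrite mulnCA.
rewrite big_cons -[X in (X)`!](prednK (rank_gt0 x)) factS prednK //.
rewrite fact0 muln1 in IH; rewrite -IH.
by rewrite -!mulnA mulnCA; congr (_ * (_ * _))%N; rewrite mulnC.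
Qed.

End Youngs.

Lemma card_Jindex n : #|Jindex n| = (\sum_(J : {set 'I_n.-1}) #|youngs J|)%N.
Proof.
rewrite -sum1_card (eq_bigr (fun J => \sum_(w in youngs J) 1))%N; last first.
  by move=> J _; rewrite sum1_card.
rewrite pair_big_dep /=; apply: eq_bigl => x; by rewrite inE.
Qed.

(** For positive [n], subsets of the generators, bit words of length one less than [n], and
    compositions of [n] correspond bijectively. *)
Lemma card_Gindex n (l : seq (seq nat)) : uniq l ->
  (forall s, (s \in l) = all (fun m => 0 < m)%N s && (sumn s == n)) ->
  #|Gindex n| = (\sum_(s <- l) \prod_(m <- s) m`!)%N.
Proof.
move=> ul lP; rewrite GindexE card_imset; last exact: blocks_pair_inj.
(* The case [n = 0] is separate: its only composition is empty, whereas [runs] never returns the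
   empty list. *)
rewrite card_Jindex; case: n lP => [|n] lP.
  have pl : perm_eq l [:: [::]].
    apply: uniq_perm => // s; rewrite lP inE.
    by case: s => [|[|p] s] //=; rewrite andbF.
  rewrite (perm_big _ pl) big_seq1 big_nil.
  rewrite (bigD1 set0) //= big1 => [|K].
    rewrite addn0 (_ : youngs _ = [set 1%g]) ?cards1 //.
    apply/setP => w; apply/idP/set1P => [_|->]; last exact: youngs1.
    by apply/permP => -[].
  by move/eqP; case; apply/setP => -[].
rewrite (perm_big _ (perm_compositions ul lP)) big_map big_enum /=.
pose word (b : n.-tuple bool) : {set 'I_n.+1.-1} := [set k | tnth b k].
pose unword (K : {set 'I_n.+1.-1}) : n.-tuple bool := [tuple k \in K | k < n].
have wordK : cancel word unword.
  by move=> b; apply: eq_from_tnth => k; rewrite tnth_mktuple inE.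
have unwordK : cancel unword word.
  by move=> K; apply/setP => k; rewrite inE tnth_mktuple.
rewrite (reindex word); last by exists unword => ? _; rewrite ?wordK ?unwordK.
apply: eq_bigr => b _; rewrite card_youngs.
suff -> : link_word (word b) = val b by [].
rewrite /link_word -[RHS](map_tnth_enum b).
by apply: eq_map => k; rewrite inE.
Qed.

End Cardinality.

(* bH_n(q) is a free S-module (S = C[q,q^-1]) with basis
   G_n = { E_I z_w | I in LP_n, w in S_||I|| }, and its dimension is
   sum over compositions (mu_1,...,mu_k) of n of mu_1! ... mu_k!.
   Equalities in bH_n(q) are expressed through its universal property:
   an identity between expressions in the generators holds in bH_n(q)
   iff it holds in every S-algebra A for every e_i, z_i in A satisfying
   the defining relations. z_w is computed along an arbitrary choice
   rw w of reduced expression of each w. *)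
Theorem theorem5p4 (n : nat) (rw : 'S_n -> seq 'I_n.-1) :
  (forall w : 'S_n, reduced_word w (rw w)) ->
  let c : S := qS - qinvS in
  let G (A : algType S) (e z : 'I_n.-1 -> A)
        (Iw : {set {set 'I_n}} * 'S_n) : A :=
      E_of e Iw.1 * z_of z (rw Iw.2) in
  (* G_n spans bH_n(q) *)
  (forall u : seq (bgen n),
     exists a : {set {set 'I_n}} * 'S_n -> S,
       forall (A : algType S) (e z : 'I_n.-1 -> A),
         bH_relations c e z ->
         eval_word e z u = \sum_(Iw in Gindex n) a Iw *: G A e z Iw) /\
  (* G_n is linearly independent over S *)
  (forall a : {set {set 'I_n}} * 'S_n -> S,
     (forall (A : algType S) (e z : 'I_n.-1 -> A),
         bH_relations c e z ->
         \sum_(Iw in Gindex n) a Iw *: G A e z Iw = 0) ->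
     forall Iw, Iw \in Gindex n -> a Iw = 0) /\
  (* dimension formula: for the list l of all compositions of n *)
  (forall l : seq (seq nat),
     uniq l ->
     (forall s : seq nat, (s \in l) = (all (fun m => 0 < m)%N s && (sumn s == n))) ->
     #|Gindex n| = (\sum_(s <- l) \prod_(m <- s) m`!)%N).
Proof.
move=> rwP c G.
have GE (A : algType S) (e z : 'I_n.-1 -> A) x :
    G A e z (blocks_pair x) = basis_elt rw e z x.
  congr (_ * _); rewrite /E_of; apply: eq_bigl => k.
  exact: joined_blocks.
split=> [u|].
  have [a ha] := spans_eval_word c rwP u.
  (* The coefficients are transported along the inverse of [blocks_pair]. *)
  exists (fun Iw => a ([set k | joined Iw.1 k], Iw.2)) => A e z ez.
  rewrite ha // Gindex_sum; apply: eq_bigr => -[J w] _; rewrite GE /=.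
  by congr (a (_, _) *: _); apply/setP => k; rewrite inE joined_blocks.
split=> [a a0 Iw|]; last exact: card_Gindex.
rewrite GindexE => /imsetP[x xJ ->].
apply: (basis_elt_free (c := c) rwP (a := a \o @blocks_pair n)) => // A e z ez.
by rewrite -[RHS](a0 A e z ez) Gindex_sum; apply: eq_bigr => y _; rewrite GE.
Qed.
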